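(* Let $n\ge 2$ be an integer. Let $\mathfrak{A}$ and $\mathfrak{A}'$ be two alternative $*$-algebras with identities $1_{\mathfrak{A}}$ and $1_{\mathfrak{A}'}$, respectively, and let $e_1$ and $e_2=1_{\mathfrak{A}}-e_1$ be nontrivial symmetric idempotents in $\mathfrak{A}$. Suppose that for each $i\in\{1,2\}$ and each $x\in\mathfrak{A}$, $x(\mathfrak{A}e_i)=\{0\}$ implies $x=0$. Suppose that $\varphi:\mathfrak{A}\to\mathfrak{A}'$ is a bijective unital map (not assumed additive) such that $$\varphi(q_{n*}(\xi,\ldots,\xi,a,b))=q_{n*}(\varphi(\xi),\ldots,\varphi(\xi),\varphi(a),\varphi(b))$$ for all $a,b\in\mathfrak{A}$ and all $\xi\in\{1_{\mathfrak{A}},e_1,e_2\}$. Then $\varphi$ is $*$-additive, i.e. $\varphi(a+b)=\varphi(a)+\varphi(b)$ and $\varphi(a^* )=\varphi(a)^*$ for all $a,b\in\mathfrak{A}$.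
   Context: The ground field is $\mathbb{C}$. An alternative $*$-algebra is a complex (not necessarily associative) algebra satisfying $x(xy)=x^2y$ and $(yx)x=yx^2$, equipped with an involution $*$ (conjugate-linear, $(ab)^*=b^*a^*$, $a^{**}=a$). An idempotent $e$ is symmetric if $e^*=e$ and nontrivial if $e\ne 0$ and $e\neq 1_{\mathfrak{A}}$. Unital means $\varphi(1_{\mathfrak{A}})=1_{\mathfrak{A}'}$. Write $\{x,y\}_*=xy+yx^*$ and define $q_{1*}(x)=x$ and $q_{n*}(x_1,\ldots,x_n)=\{q_{(n-1)*}(x_1,\ldots,x_{n-1}),x_n\}_*$ for $n\ge2$. In $q_{n*}(\xi,\ldots,\xi,a,b)$ the element $\xi$ occurs $n-2$ times. $\mathfrak{A}e_i=\{ae_i: a\in\mathfrak{A}\}$. *)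

(* Defs.v *)
From HB Require Import structures.
From mathcomp Require Import all_boot all_order all_algebra.
From mathcomp Require Import reals complex.

Set Implicit Arguments.
Unset Strict Implicit.
Unset Printing Implicit Defensive.

Import GRing.Theory.
Local Open Scope ring_scope.

Declare Scope nonassoc_scope.
Open Scope nonassoc_scope.

(* The product is that of a unital, not necessarily associative, magma;      *)
(* its identity is written 1%g. The plain "*" and "1" of ring_scope are not  *)
(* available, since ring structures are associative.                         *)
Notation "x ** y" := (@monoid.mul _ x y)
  (at level 40, left associativity) : nonassoc_scope.

HB.mixin Record Lmodule_isNonAssocAlgebra (K : comNzRingType) A
    of GRing.Lmodule K A & UMagma A := {
  amulDl : forall x y z : A, (x + y) ** z = x ** z + y ** z;
  amulDr : forall x y z : A, x ** (y + z) = x ** y + x ** z;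
  ascaleAl : forall (k : K) (x y : A), (k *: x) ** y = k *: (x ** y);
  ascaleAr : forall (k : K) (x y : A), x ** (k *: y) = k *: (x ** y)
}.

#[short(type="nonAssocAlgType")]
HB.structure Definition NonAssocAlgebra (K : comNzRingType) :=
  {A of GRing.Lmodule K A & UMagma A & Lmodule_isNonAssocAlgebra K A}.

HB.mixin Record NonAssocAlgebra_isAlternative (K : comNzRingType) A
    of NonAssocAlgebra K A := {
  alternl : forall x y : A, x ** (x ** y) = (x ** x) ** y;
  alternr : forall x y : A, (y ** x) ** x = y ** (x ** x)
}.

#[short(type="altAlgType")]
HB.structure Definition AltAlgebra (K : comNzRingType) :=
  {A of NonAssocAlgebra K A & NonAssocAlgebra_isAlternative K A}.

HB.mixin Record AltAlgebra_hasStar (C : numClosedFieldType) A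
    of AltAlgebra C A := {
  star : A -> A;
  starD : forall x y : A, star (x + y) = star x + star y;
  starZ : forall (k : C) (x : A), star (k *: x) = Num.conj k *: star x;
  starM : forall x y : A, star (x ** y) = star y ** star x;
  starK : forall x : A, star (star x) = x
}.

#[short(type="altStarAlgType")]
HB.structure Definition AltStarAlgebra (C : numClosedFieldType) :=
  {A of AltAlgebra C A & AltAlgebra_hasStar C A}.

Section StarProducts.
Variables (C : numClosedFieldType) (A : altStarAlgType C).
Implicit Types (e x y : A) (s : seq A).

Definition nontrivial_symmetric_idempotent e : Prop :=
  [/\ e ** e = e, star e = e, e <> 0 & e <> 1%g].

Definition starprod x y : A := x ** y + y ** star x.

(* q_{n*}(x_1, ..., x_n) is qstar [:: x_1; ...; x_n]; the arity n is the     *)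
(* size of the list, and the value on the empty list is irrelevant.          *)
Definition qstar s : A := if s is x :: s' then foldl starprod x s' else 0.

Lemma qstar1 x : qstar [:: x] = x.
Proof. by []. Qed.

Lemma qstar_rcons s x :
  (0 < size s)%N -> qstar (rcons s x) = starprod (qstar s) x.
Proof. by case: s => //= y s _; rewrite foldl_rcons. Qed.

End StarProducts.

(* Main.v *)
Require Import Defs.
From HB Require Import structures.
From mathcomp Require Import all_boot all_order all_algebra.
From mathcomp Require Import reals complex.

Set Implicit Arguments.
Unset Strict Implicit.
Unset Printing Implicit Defensive.

Local Open Scope ring_scope.

(** The hypothesis for [xi = 1] alone gives
    [phi (k {a, b}) = k {phi a, phi b}] with [k = 2 ^ (n - 2)]; taking [a = 1]
    as well shows that [phi] commutes with multiplication by [2 k], hence that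
    [phi] preserves the normalised product [a \star b = 2^-1 (a b + b (star a))]
    exactly, whatever [n] is.

    Let [z] satisfy [phi z = phi x + phi y], which is possible since [phi] is
    onto, and let [d = z - (x + y)]; additivity of [phi] means [d = 0]. If
    [T] is a composite of multiplications by fixed elements on either side of
    [\star], then [phi (T z) = phi (T x) + phi (T y)]; so as soon as [phi] is
    known to be additive on the pair [T x], [T y] (for example because one of
    them vanishes), injectivity gives [T d = 0] ([defect_eq0]). The proof
    consists in choosing such operators, with additivity being established on
    larger and larger sets, until their common kernel is trivial. Write [e], [f]
    for the two idempotents and [A_ef] for the Peirce component [e A f].

    - The operator [x |-> e x + x e - x] kills the off-diagonal part of [x] and
      [x |-> i (e x - x e)] kills the diagonal part; together they separate
      the two, so [phi] is additive on a diagonal plus an off-diagonal element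
      ([phi_add_diag_offdiag]).
    - For [x], [y] in [A_ef], expanding [(e + 2 x) \star (f + 2 y)] produces
      the sum [x + y] out of a product, among junk which multiplication
      by [f] removes: [phi] is additive on the elements [x + star x]
      ([phi_add_real_offdiag]), and then on [A_ef] ([phi_add_offdiag]).
    - For arbitrary [x], [y], operators with values in the sets above give first
      [e d = d e] ([defect_commutes]) and then [(e d) t = 0] for all [t] in
      [A_ef], so that [e d] annihilates [A f] and vanishes by the nondegeneracy
      hypothesis ([defect_corner_eq0]). Exchanging [e] and [f], [d = 0].

    Compatibility with the involution follows by applying additivity to
    [a \star 1 = 2^-1 (a + star a)]. *)

Import GRing.Theory Num.Theory.

(** * Alternative algebras and Peirce components *)

Section NonAssoc.
Variables (K : comNzRingType) (A : nonAssocAlgType K).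
Implicit Types x y z : A.

Lemma amul0l x : 0 ** x = 0.
Proof. by apply: (@addrI _ (0 ** x)); rewrite -amulDl !addr0. Qed.

Lemma amul0r x : x ** 0 = 0.
Proof. by apply: (@addrI _ (x ** 0)); rewrite -amulDr !addr0. Qed.

Lemma amulNl x y : (- x) ** y = - (x ** y).
Proof. by rewrite -scaleN1r ascaleAl scaleN1r. Qed.

Lemma amulNr x y : x ** (- y) = - (x ** y).
Proof. by rewrite -scaleN1r ascaleAr scaleN1r. Qed.

Lemma amulBl x y z : (x - y) ** z = x ** z - y ** z.
Proof. by rewrite amulDl amulNl. Qed.

Lemma amulBr x y z : x ** (y - z) = x ** y - x ** z.
Proof. by rewrite amulDr amulNr. Qed.

End NonAssoc.

Section Alternative.
Variables (K : comNzRingType) (A : altAlgType K).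
Implicit Types e x y z : A.

Lemma alternl_polar x y z : x ** (y ** z) + y ** (x ** z) = (x ** y + y ** x) ** z.
Proof.
have := alternl (x + y) z.
rewrite !(amulDl, amulDr) !alternl -!addrA => /addrI.
by rewrite !addrA => /addIr.
Qed.

Lemma alternr_polar x y z : (z ** x) ** y + (z ** y) ** x = z ** (x ** y + y ** x).
Proof.
have := alternr (x + y) z.
rewrite !(amulDl, amulDr) !alternr -!addrA => /addrI.
by rewrite !addrA => /addIr <-; rewrite addrC.
Qed.

Section Idempotent.
Variable e : A.
Hypothesis ee : e ** e = e.

Lemma idem_mulK x : e ** (e ** x) = e ** x.
Proof. by rewrite alternl ee. Qed.

Lemma idem_mulKr x : (x ** e) ** e = x ** e.
Proof. by rewrite alternr ee. Qed.

Lemma idem_mulA x : (e ** x) ** e = e ** (x ** e).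
Proof.
by have := alternr_polar x e e; rewrite ee amulDr idem_mulK => /addIr.
Qed.

(** [A_ef] when [e + f = 1], expressed through [e] alone. *)
Definition offdiag x := e ** x = x /\ x ** e = 0.

Lemma offdiagZ k x : offdiag x -> offdiag (k *: x).
Proof. by case=> ex xe; split; rewrite ?(ascaleAl, ascaleAr) ?ex ?xe ?scaler0. Qed.

Lemma offdiagD x y : offdiag x -> offdiag y -> offdiag (x + y).
Proof.
by move=> [ex xe] [ey ye]; split; rewrite ?amulDl ?amulDr ?ex ?ey ?xe ?ye ?addr0.
Qed.

(** The Peirce rule [A_ee A_ef <= A_ef]; each polarised alternative law gives
    one of the two conditions. *)
Lemma corner_mul_offdiag c t :
  e ** c = c -> c ** e = c -> offdiag t -> offdiag (c ** t).
Proof.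
move=> ec ce [et te]; split.
  have := alternl_polar e c t.
  by rewrite et ec ce amulDl => /addIr.
have := alternr_polar t e c.
by rewrite te et ce add0r -[RHS]add0r => /addIr.
Qed.

End Idempotent.
End Alternative.

(** * Complementary symmetric idempotents *)

Section StarAlgebra.
Variables (C : numClosedFieldType) (A : altStarAlgType C).
Implicit Types e f x y z : A.

Lemma halfD x : 2^-1 *: (x + x) = x.
Proof. by rewrite -mulr2n -scaler_nat scalerA mulVf ?scale1r ?pnatr_eq0. Qed.

Lemma double_eq0 x : x + x = 0 -> x = 0.
Proof. by move=> x0; rewrite -[x]halfD x0 scaler0. Qed.

Lemma star0 : star (0 : A) = 0.
Proof. by apply: (@addrI _ (star 0)); rewrite -starD !addr0. Qed.

Lemma starN x : star (- x) = - star x.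
Proof. by apply: (@addrI _ (star x)); rewrite -starD !subrr star0. Qed.

Lemma star1 : star (1%g : A) = 1%g.
Proof. by rewrite -[LHS]mulg1 -[X in _ ** X]starK -starM mulg1 starK. Qed.

(** The rule [A f A_ee = 0] when [e + f = 1]: the polarised law makes [x y] an
    eigenvector of right multiplication by the idempotent [e] for the impossible
    eigenvalue [2]. *)
Lemma mul_corner_eq0 e x y :
  e ** e = e -> x ** e = 0 -> e ** y = y -> y ** e = y -> x ** y = 0.
Proof.
move=> ee xe ey ye.
have xye : (x ** y) ** e = x ** y + x ** y.
  by have := alternr_polar e y x; rewrite xe amul0l add0r ey ye amulDr.
apply: double_eq0; rewrite -xye.
by apply: (@addrI _ ((x ** y) ** e)); rewrite addr0 -amulDl -xye (idem_mulKr ee).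
Qed.

Definition symm_frame e f := [/\ e ** e = e, star e = e & e + f = 1%g].

Lemma symm_frame_sym e f : symm_frame e f -> symm_frame f e.
Proof.
case=> ee es ef; have -> : f = 1%g - e by rewrite -ef addrC addKr.
split; last by rewrite subrK.
  by rewrite amulBl !amulBr !mul1g mulg1 ee subrr subr0.
by rewrite starD starN star1 es.
Qed.

Section Frame.
Variables e f : A.
Hypothesis ef : symm_frame e f.

Let ee : e ** e = e. Proof. by case: ef. Qed.
Let es : star e = e. Proof. by case: ef. Qed.
Let fE : f = 1%g - e. Proof. by case: ef => _ _ <-; rewrite addrC addKr. Qed.

Lemma frame_mull x : f ** x = x - e ** x.
Proof. by rewrite fE amulBl mul1g. Qed.

Lemma frame_mulr x : x ** f = x - x ** e.
Proof. by rewrite fE amulBr mulg1. Qed.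

Lemma offdiag_frame x : offdiag e ((e ** x) ** f).
Proof.
rewrite frame_mulr; split.
  by rewrite amulBr idem_mulK // idem_mulA // idem_mulK.
by rewrite amulBl idem_mulKr // subrr.
Qed.

(** Both products [x y] in [A_ef A_ef <= A_fe] and [y (star x)] in
    [A_ef A_fe <= A_ee] have zero component in [A f]. *)
Lemma starprod_offdiag_mulr x y :
  offdiag e x -> offdiag e y -> starprod x y ** f = 0.
Proof.
move=> [ex xe] [ey ye].
have xye : (x ** y) ** e = x ** y.
  have := alternr_polar y e x.
  by rewrite xe amul0l addr0 ye ey add0r.
have yxe : (y ** star x) ** e = y ** star x.
  have xse : star x ** e = star x by rewrite -[e]es -starM ex.
  have exs : e ** star x = 0 by rewrite -[e]es -starM xe star0.
  have := alternr_polar (star x) e y.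
  by rewrite ye amul0l addr0 xse exs addr0.
by rewrite frame_mulr amulDl xye yxe subrr.
Qed.

(** Since [e x + x e - x] is the difference of the two diagonal components
    of [x], and [e x - x e] that of the two off-diagonal ones, the hypotheses
    leave no component of [d]. *)
Lemma diag_offdiag_eq0 d : e ** d + d ** e = d -> e ** d = d ** e -> d = 0.
Proof.
move=> dE ed; move: (dE); rewrite -ed => dE2.
have ed0 : e ** d = 0.
  apply: (@addrI _ (e ** d)); rewrite addr0.
  by rewrite -[in RHS]dE2 amulDr idem_mulK.
by rewrite -dE2 ed0 addr0.
Qed.

(** For an off-diagonal [d], the element [d e] is in [A_fe] and its adjoint
    in [A_ef], so that they cannot cancel each other. *)
Lemma offdiag_mulr_eq0 d :
  e ** d + d ** e = d -> d ** e + star (d ** e) = 0 -> d ** e = 0.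
Proof.
move=> dE dre.
have ede : e ** (d ** e) = 0.
  apply: (@addrI _ (e ** d)).
  by rewrite -{1}[e ** d]idem_mulK // -amulDr dE addr0.
have sE : star (d ** e) = e ** star d by rewrite starM es.
have sN : star (d ** e) = - (d ** e) by apply/eqP; rewrite -addr_eq0 addrC dre.
apply: oppr_inj.
by rewrite oppr0 -sN sE -idem_mulK // -sE sN amulNr ede oppr0.
Qed.

End Frame.

Lemma star_frame_eq0 e f d : symm_frame e f ->
    e ** d + d ** e = d -> d ** e + star (d ** e) = 0 ->
  d ** f + star (d ** f) = 0 -> d = 0.
Proof.
move=> ef dE dre drf; have fe := symm_frame_sym ef.
have fdE : f ** d + d ** f = d.
  by rewrite (frame_mull ef) (frame_mulr ef) addrACA -opprD dE addrK.
rewrite -[LHS](subrK (d ** e)) -(frame_mulr ef).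
by rewrite (offdiag_mulr_eq0 ef) // (offdiag_mulr_eq0 fe) // addr0.
Qed.

(** The factor makes [1%g] a left identity. *)
Definition half_starprod x y := 2^-1 *: starprod x y.
Local Notation "x \star y" := (half_starprod x y)
  (at level 40, left associativity).

Lemma half_starprodDl x y z : (x + y) \star z = x \star z + y \star z.
Proof.
by rewrite /half_starprod -scalerDr /starprod starD amulDl amulDr addrACA.
Qed.

Lemma half_starprodDr x y z : x \star (y + z) = x \star y + x \star z.
Proof. by rewrite /half_starprod -scalerDr /starprod amulDl amulDr addrACA. Qed.

Lemma half_starprod_expand x1 x2 y1 y2 z :
  ((x1 + x2) \star (y1 + y2)) \star z =
  ((x1 \star y1) \star z + (x1 \star y2) \star z) +
  ((x2 \star y1) \star z + (x2 \star y2) \star z).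
Proof.
by rewrite half_starprodDl !half_starprodDr !half_starprodDl.
Qed.

Lemma half_starprod0l x : 0 \star x = 0.
Proof. by rewrite /half_starprod /starprod star0 amul0l amul0r addr0 scaler0. Qed.

Lemma half_starprod_doubled x y : x \star y + x \star y = starprod x y.
Proof. by rewrite /half_starprod -scalerDr halfD. Qed.

Lemma half_starprod_doublel x y : (x + x) \star y = starprod x y.
Proof. by rewrite half_starprodDl half_starprod_doubled. Qed.

Lemma half_starprod_doubler x y : x \star (y + y) = starprod x y.
Proof. by rewrite half_starprodDr half_starprod_doubled. Qed.

Lemma starprod_pow2 k x y : starprod (2 ^+ k *: x) y = 2 ^+ k *: starprod x y.
Proof.
by rewrite /starprod starZ rmorphXn /= conjC_nat ascaleAl ascaleAr -scalerDr.
Qed.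

Lemma starprod1l x : starprod 1%g x = x + x.
Proof. by rewrite /starprod star1 mul1g mulg1. Qed.

Lemma qstar_ones k a b :
  qstar (nseq k (1%g : A) ++ [:: a; b]) = 2 ^+ k *: starprod a b.
Proof.
have one x : starprod 1%g x = 2 *: x by rewrite starprod1l scaler_nat.
have fold_ones m j : foldl (@starprod C A) (2 ^+ j *: 1%g) (nseq m 1%g ++ [:: a; b])
    = 2 ^+ (j + m).+1 *: starprod a b.
  elim: m j => [|m IH] j /=; rewrite starprod_pow2 one scalerA -exprSr.
    by rewrite addn0 starprod_pow2.
  by rewrite IH addSnnS.
case: k => [|k]; first by rewrite expr0 scale1r.
by have := fold_ones k 0; rewrite expr0 scale1r.
Qed.

End StarAlgebra.

Notation "x \star y" := (half_starprod x y)
  (at level 40, left associativity) : nonassoc_scope.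

(** * Additivity of maps preserving the normalised star product *)

Section Additivity.
Variables (C : numClosedFieldType) (A A' : altStarAlgType C) (phi : A -> A').
Hypothesis phi_inj : injective phi.
Hypothesis phi_surj : forall y, exists x, phi x = y.
Hypothesis phi_star : forall a b, phi (a \star b) = phi a \star phi b.
Implicit Types (e f x y z t : A) (T : A -> A).

Lemma phi0 : phi 0 = 0.
Proof.
have [b b0] := phi_surj 0.
by rewrite -(half_starprod0l b) phi_star b0 /half_starprod /starprod
     amul0r amul0l addr0 scaler0.
Qed.

(** [T] is additive both for the sum of [A] and for the sum of [A'] pulled back
    along [phi]; the second property is stated without an inverse of [phi]. *)
Definition sum_operator T : Prop :=
  {morph T : x y / x + y} /\
  (forall x y z, phi z = phi x + phi y -> phi (T z) = phi (T x) + phi (T y)).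

Lemma sum_operator_ext T1 T2 : T1 =1 T2 -> sum_operator T1 -> sum_operator T2.
Proof.
by move=> eqT [D T1P]; split=> x y => [|z /T1P]; rewrite -!eqT.
Qed.

Lemma sum_operator_comp T1 T2 :
  sum_operator T1 -> sum_operator T2 -> sum_operator (T1 \o T2).
Proof.
move=> [D1 P1] [D2 P2]; split=> [x y|x y z /P2 /P1 //].
by rewrite /= D2 D1.
Qed.

Lemma sum_operator_mull t : sum_operator (fun x => t \star x).
Proof.
split=> [x y|x y z zE]; first exact: half_starprodDr.
by rewrite !phi_star zE half_starprodDr.
Qed.

Lemma sum_operator_mulr t : sum_operator (fun x => x \star t).
Proof.
split=> [x y|x y z zE]; first exact: half_starprodDl.
by rewrite !phi_star zE half_starprodDl.
Qed.

(** Doubling the fixed factor removes the [1/2] of [\star]. *)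
Lemma sum_operator_starprodl t : sum_operator (starprod t).
Proof.
by apply: sum_operator_ext (sum_operator_mull (t + t)) => x; rewrite half_starprod_doublel.
Qed.

Lemma sum_operator_starprodr t : sum_operator (fun x => starprod x t).
Proof.
by apply: sum_operator_ext (sum_operator_mulr (t + t)) => x; rewrite half_starprod_doubler.
Qed.

Lemma defect_eq0 T x y z :
    sum_operator T -> phi z = phi x + phi y ->
  phi (T x + T y) = phi (T x) + phi (T y) -> T (z - (x + y)) = 0.
Proof.
move=> [D P] /P zE; rewrite -zE => /phi_inj TE.
by apply: (@addIr _ (T (x + y))); rewrite -D subrK add0r D.
Qed.

Lemma defect_eq0l T x y z :
  sum_operator T -> phi z = phi x + phi y -> T x = 0 -> T (z - (x + y)) = 0.
Proof. by move=> TP zE Tx0; apply: defect_eq0; rewrite // Tx0 phi0 !add0r. Qed.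

Lemma defect_eq0r T x y z :
  sum_operator T -> phi z = phi x + phi y -> T y = 0 -> T (z - (x + y)) = 0.
Proof. by move=> TP zE Ty0; apply: defect_eq0; rewrite // Ty0 phi0 !addr0. Qed.

Lemma additive_of_defect x y :
  (forall z, phi z = phi x + phi y -> z - (x + y) = 0) ->
  phi (x + y) = phi x + phi y.
Proof.
move=> d0; have [z zE] := phi_surj (phi x + phi y).
by rewrite -zE; congr phi; apply/eqP; rewrite eq_sym -subr_eq0 d0.
Qed.

(** The difference of the diagonal Peirce projections is multiplication
    by [e - (1 - e)]. *)
Lemma sum_operator_diag e :
  star e = e -> sum_operator (fun x => e ** x + x ** e - x).
Proof.
move=> es; apply: sum_operator_ext (sum_operator_mull (e - (1%g - e))) => x.
rewrite -[RHS]halfD; congr (_ *: _).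
rewrite /starprod !starD !starN !starD !starN star1 es.
rewrite !(amulBl, amulBr) mul1g mulg1 !opprB.
by rewrite [LHS]addrACA [X in _ + X = _]addrACA [RHS]addrACA !addrA.
Qed.

(** On the left, the self-adjoint [e] only yields a Jordan multiplication,
    whereas the skew element [i e] yields the commutator with [e]. *)
Lemma sum_operator_commutator e :
  star e = e -> sum_operator (fun x => 'i *: (e ** x - x ** e)).
Proof.
move=> es; apply: sum_operator_ext (sum_operator_starprodl ('i *: e)) => x.
by rewrite /starprod starZ conjCi es scaleNr amulNr ascaleAl ascaleAr scalerBr.
Qed.

Lemma commutator_eq0 e d : 'i *: (e ** d - d ** e) = 0 -> e ** d = d ** e.
Proof.
by move/eqP; rewrite scaler_eq0 (negPf (neq0Ci _)) subr_eq0 => /eqP.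
Qed.

Lemma sum_operator_real e :
  star e = e -> sum_operator (fun x => x ** e + star (x ** e)).
Proof.
move=> es; apply: sum_operator_ext (sum_operator_starprodr e) => x.
by rewrite /starprod starM es.
Qed.

Section Frame.
Variables e f : A.
Hypothesis ef : symm_frame e f.

Let fe : symm_frame f e := symm_frame_sym ef.
Let ee : e ** e = e. Proof. by case: ef. Qed.
Let es : star e = e. Proof. by case: ef. Qed.
Let fs : star f = f. Proof. by case: fe. Qed.

Lemma phi_add_diag_offdiag x y :
  e ** x = x ** e -> e ** y + y ** e = y -> phi (x + y) = phi x + phi y.
Proof.
move=> xP yP; apply: additive_of_defect => z zE.
apply: (diag_offdiag_eq0 ef).
  apply/eqP; rewrite -subr_eq0; apply/eqP.
  by apply: (defect_eq0r (sum_operator_diag es) zE); rewrite yP subrr.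
apply: commutator_eq0.
by apply: (defect_eq0l (sum_operator_commutator es) zE); rewrite xP subrr scaler0.
Qed.

Lemma offdiag_jordan x : offdiag e x -> e ** x + x ** e = x.
Proof. by case=> -> ->; rewrite addr0. Qed.

Lemma offdiag_frame_mulr x : offdiag e x -> x ** f = x.
Proof. by case=> _ xe; rewrite (frame_mulr ef) xe subr0. Qed.

Lemma star_offdiag_mulr x : offdiag e x -> star x ** f = 0.
Proof.
by case=> ex _; rewrite -fs -starM (frame_mull ef) ex subrr star0.
Qed.

Lemma starprod_frame x : starprod x f = x ** f + star (x ** f).
Proof. by rewrite starM fs. Qed.

(** In the expansion of [(e + 2 x) \star (f + 2 y)], the term [e \star 2 y] is
    [y], the term [2 x \star f] is [x + star x], and the other two have no
    component in [A f]. Right multiplication by [2 f], which maps [v] to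
    [v f + star (v f)], removes the latter, turns [y] into [y + star y] and
    preserves [x + star x]. *)
Lemma phi_add_real_offdiag x y : offdiag e x -> offdiag e y ->
  phi ((x + star x) + (y + star y)) = phi (x + star x) + phi (y + star y).
Proof.
move=> xP yP.
have x2P := offdiagD xP xP; have y2P := offdiagD yP yP.
have [ff _ _] := fe.
have add_e : phi (e + (x + x)) = phi e + phi (x + x).
  by apply: phi_add_diag_offdiag; [ | exact: offdiag_jordan].
have add_f : phi (f + (y + y)) = phi f + phi (y + y).
  apply: phi_add_diag_offdiag; last exact: offdiag_jordan.
  by rewrite (frame_mull fe) (frame_mulr fe) ff.
have ef0 : (e \star f) \star (f + f) = 0.
  rewrite /(e \star f) /starprod es (frame_mulr ef) (frame_mull ef) ee subrr addr0.
  by rewrite scaler0 half_starprod0l.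
have ey : (e \star (y + y)) \star (f + f) = y + star y.
  rewrite !half_starprod_doubler {2}/starprod es offdiag_jordan //.
  by rewrite starprod_frame offdiag_frame_mulr.
have xf : ((x + x) \star f) \star (f + f) = x + star x.
  rewrite half_starprod_doublel half_starprod_doubler !starprod_frame.
  by rewrite amulDl !(offdiag_frame_mulr xP) (star_offdiag_mulr xP) addr0.
have xy : ((x + x) \star (y + y)) \star (f + f) = 0.
  rewrite half_starprod_doublel half_starprod_doubler starprod_frame.
  by rewrite (starprod_offdiag_mulr ef) // star0 addr0.
have : phi (((e + (x + x)) \star (f + (y + y))) \star (f + f)) =
    ((phi e + phi (x + x)) \star (phi f + phi (y + y))) \star phi (f + f).
  by rewrite !phi_star add_e add_f.
rewrite [X in phi X = _]half_starprod_expand [RHS]half_starprod_expand -!phi_star.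
rewrite ef0 ey xf xy phi0 !add0r !addr0.
by rewrite addrC => ->; rewrite addrC.
Qed.

(** A defect of a pair in [A_ef] is seen by the difference of the diagonal
    projections and by multiplication by [e], which vanish on [A_ef], and
    by multiplication by [f], which maps [x] to [x + star x]. *)
Lemma phi_add_offdiag x y : offdiag e x -> offdiag e y ->
  phi (x + y) = phi x + phi y.
Proof.
move=> xP yP; apply: additive_of_defect => z zE.
have [_ xe] := xP.
apply: (star_frame_eq0 ef).
- apply/eqP; rewrite -subr_eq0; apply/eqP.
  apply: (defect_eq0l (sum_operator_diag es) zE).
  by rewrite offdiag_jordan ?subrr.
- by apply: (defect_eq0l (sum_operator_real es) zE); rewrite xe star0 addr0.
apply: (defect_eq0 (sum_operator_real fs) zE).
by rewrite !offdiag_frame_mulr // phi_add_real_offdiag.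
Qed.

(** The commutator with [e], followed by right multiplication by [f], takes
    values in [A_ef]; so the composite operator has values in the set of the
    [v + star v], [v] in [A_ef], where [phi] is additive. *)
Lemma defect_commutator_mulr x y z : phi z = phi x + phi y ->
  let w := 'i *: (e ** (z - (x + y)) - (z - (x + y)) ** e) in
  w ** f + star (w ** f) = 0.
Proof.
move=> zE /=.
have opP := sum_operator_comp (sum_operator_real fs) (sum_operator_commutator es).
apply: (defect_eq0 opP zE) => /=.
have offP u : offdiag e (('i *: (e ** u - u ** e)) ** f).
  have -> : ('i *: (e ** u - u ** e)) ** f = 'i *: ((e ** u) ** f).
    by rewrite ascaleAl amulBl [(u ** e) ** f](frame_mulr ef) idem_mulKr // subrr subr0.
  exact: offdiagZ (offdiag_frame ef u).
exact: phi_add_real_offdiag.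
Qed.

End Frame.

(** The element [i (e d - d e)] is off-diagonal, and the preceding lemma,
    applied to both orderings of the two idempotents, makes it satisfy the
    remaining hypotheses of [star_frame_eq0]. *)
Lemma defect_commutes e f x y z : symm_frame e f -> phi z = phi x + phi y ->
  e ** (z - (x + y)) = (z - (x + y)) ** e.
Proof.
move=> ef zE; have fe := symm_frame_sym ef; have [ee _ _] := ef.
move: (defect_commutator_mulr fe zE) (defect_commutator_mulr ef zE) => /=.
move: (z - (x + y)) => d we wf.
apply: commutator_eq0; apply: (star_frame_eq0 ef) wf.
  rewrite !(ascaleAl, ascaleAr) -scalerDr amulBl amulBr idem_mulK // idem_mulKr //.
  by rewrite idem_mulA // addrA subrK.
have fdE : f ** d - d ** f = - (e ** d - d ** e).
  by rewrite (frame_mull ef) (frame_mulr ef) !opprB addrC addrA subrK.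
apply: oppr_inj; rewrite oppr0 opprD -starN -amulNl -scalerN -fdE.
exact: we.
Qed.

(** For [t] in [A_ef], the map [x |-> (e x e) t] is a composite of
    multiplications with values in [A_ef], where [phi] is additive; hence
    [e d], which equals [e d e], annihilates [A_ef]. By the Peirce rules it
    annihilates [A_ff] too, hence all of [A f = A_ef + A_ff]. *)
Lemma defect_corner_eq0 e f x y z :
    symm_frame e f ->
    (forall u : A, (forall a, u ** (a ** f) = 0) -> u = 0) ->
  phi z = phi x + phi y -> e ** (z - (x + y)) = 0.
Proof.
move=> ef nondeg zE; have fe := symm_frame_sym ef.
have [ee es _] := ef; have [ff _ _] := fe.
have ed := defect_commutes ef zE.
set d := z - (x + y) in ed *.
have edt t : offdiag e t -> (e ** d) ** t = 0.
  move=> tP; have [et te] := tP.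
  have opP : sum_operator (fun u => ((e ** u) ** e) ** t).
    have := sum_operator_comp (sum_operator_mulr t)
      (sum_operator_comp (sum_operator_diag es) (sum_operator_starprodl e)).
    apply: sum_operator_ext => u /=.
    have -> : e ** starprod e u + starprod e u ** e - starprod e u
        = (e ** u) ** e + (e ** u) ** e.
      rewrite /starprod es amulDl amulDr idem_mulK // idem_mulKr // idem_mulA //.
      by rewrite [X in _ + X - _]addrC addrACA [LHS]addrC addKr.
    rewrite half_starprod_doublel /starprod !starM es -[RHS]addr0; congr (_ + _).
    apply: (mul_corner_eq0 ee te); first by rewrite idem_mulK.
    by rewrite idem_mulA // idem_mulKr.
  have := defect_eq0 opP zE.
  (* As [d] commutes with [e], the corner [e d e] is [e d]. *)
  rewrite /= -/d [(e ** d) ** e]idem_mulA // -ed idem_mulK //; apply.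
  have corner u : offdiag e (((e ** u) ** e) ** t).
    by apply: corner_mul_offdiag; rewrite ?idem_mulKr // idem_mulA // idem_mulK.
  exact: (phi_add_offdiag ef).
apply: nondeg => a.
rewrite -[a ** f](subrK (e ** (a ** f))) -(frame_mull ef) amulDr.
rewrite [X in _ + X]edt ?addr0; last first.
  have -> : e ** (a ** f) = (e ** a) ** f.
    by rewrite !(frame_mulr ef) amulBr idem_mulA.
  exact: offdiag_frame ef _.
apply: (mul_corner_eq0 ff).
- by rewrite (frame_mulr ef) ed idem_mulKr // subrr.
- by rewrite idem_mulK.
by rewrite -idem_mulA // idem_mulKr.
Qed.

Lemma phi_additive e f x y :
    symm_frame e f ->
    (forall u : A, (forall a, u ** (a ** e) = 0) -> u = 0) ->
    (forall u : A, (forall a, u ** (a ** f) = 0) -> u = 0) ->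
  phi (x + y) = phi x + phi y.
Proof.
move=> ef nde ndf; apply: additive_of_defect => z zE.
rewrite -[LHS](subrK (e ** (z - (x + y)))) -(frame_mull ef).
rewrite (defect_corner_eq0 ef ndf zE).
by rewrite (defect_corner_eq0 (symm_frame_sym ef) nde zE) addr0.
Qed.

End Additivity.

(** Since [{1, b} = 2 b], the map [phi] commutes with multiplication by
    [2 ^ (k + 1)], which is what turns the factor [2 ^ k] into [1/2]. *)
Lemma half_starprod_of_qstar (C : numClosedFieldType) (A A' : altStarAlgType C)
    (k : nat) (phi : A -> A') :
    phi 1%g = 1%g ->
    (forall a b, phi (qstar (nseq k 1%g ++ [:: a; b])) =
       qstar (nseq k 1%g ++ [:: phi a; phi b])) ->
  forall a b, phi (a \star b) = phi a \star phi b.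
Proof.
move=> phi1 phi_q a b.
have {}phi_q x y : phi (2 ^+ k *: starprod x y) = 2 ^+ k *: starprod (phi x) (phi y).
  by rewrite -!qstar_ones.
have pow2_neq0 : 2 ^+ k != 0 :> C by rewrite expf_neq0 // pnatr_eq0.
have := phi_q 1%g (a \star b).
rewrite phi1 !starprod1l half_starprod_doubled phi_q => /(scalerI pow2_neq0) E.
by rewrite /(phi a \star phi b) E halfD.
Qed.

Theorem theorem2p1 (R : realType) (n : nat) (hn : (2 <= n)%N)
  (A A' : altStarAlgType R[i]) (e1 e2 : A)
  (he2 : e2 = 1%g - e1)
  (he1_idem : nontrivial_symmetric_idempotent e1)
  (he2_idem : nontrivial_symmetric_idempotent e2)
  (hA : forall e : A, e = e1 \/ e = e2 ->
        forall x : A, (forall a : A, x ** (a ** e) = 0) -> x = 0)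
  (phi : A -> A')
  (phi_bij : bijective phi)
  (phi_unital : phi 1%g = 1%g)
  (phi_qstar : forall a b xi : A, [\/ xi = 1%g, xi = e1 | xi = e2] ->
     phi (qstar (nseq (n - 2) xi ++ [:: a; b])) =
     qstar (nseq (n - 2) (phi xi) ++ [:: phi a; phi b])) :
  (forall a b : A, phi (a + b) = phi a + phi b) /\
  (forall a : A, phi (star a) = star (phi a)).
Proof.
have [[e1e1 e1s _ _] [e2e2 e2s _ _]] := (he1_idem, he2_idem).
have frame : symm_frame e1 e2 by split; rewrite // he2 addrC subrK.
have [psi phiK psiK] := phi_bij.
have phi_inj : injective phi := can_inj phiK.
have phi_surj y : exists x, phi x = y by exists (psi y).
have phi_star a b : phi (a \star b) = phi a \star phi b.
  apply: (half_starprod_of_qstar (k := n - 2) phi_unital) => x y.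
  by rewrite phi_qstar; [rewrite phi_unital | constructor 1].
have phiD a b : phi (a + b) = phi a + phi b.
  apply: (phi_additive phi_inj phi_surj phi_star _ _ frame).
    by apply: hA; left.
  by apply: hA; right.
split=> // a.
apply: (@addrI _ (phi a)); rewrite -phiD.
have one_r (B : altStarAlgType R[i]) (b : B) : b + star b = b \star 1%g + b \star 1%g.
  by rewrite half_starprod_doubled /starprod mul1g mulg1.
by rewrite !one_r phiD phi_star phi_unital.
Qed.
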